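(* Let $A\in\mathbb{R}^{m\times n}$, a positive integer $s\le m$, $\kappa<1/2$, $q\in[1,\infty]$ and a contrast matrix $H=[h_1,\dots,h_n]\in\mathbb{R}^{m\times n}$ be such that $H$ satisfies the condition $\mathbf{H}_{s,q}(\kappa)$. Let also $\sigma>0$, an uncertainty set $\mathcal{U}\subset\mathbb{R}^m$ and $\epsilon\in(0,1)$ be given, and let $\nu_i=\nu_{\epsilon,\sigma,\mathcal{U}}(h_i)$, $\nu(H)=\max_i\nu_i$. (i) Consider the regular recovery $\widehat{x}_{\rm reg}$ with the contrast matrix $H$ and parameters $\rho_i\ge\nu_i$, $1\le i\le n$, and let $\widehat\rho=\max_i\rho_i$. Then for all $1\le p\le q$ and $\upsilon\ge0$ $$\mathrm{Risk}_p(\widehat{x}_{\rm reg}(\cdot)\,|\,\epsilon,\sigma,s,\upsilon)\le(3s)^{1/p}\,\frac{\widehat\rho+\nu(H)+s^{-1}\upsilon}{1-2\kappa}.$$ (ii) Consider the penalized recovery $\widehat{x}_{\rm pen}$ with the contrast matrix $H$, the given $s$, and $\theta=2$. Then for all $1\le p\le q$ and $\upsilon\ge0$ $$\mathrm{Risk}_p(\widehat{x}_{\rm pen}(\cdot)\,|\,\epsilon,\sigma,s,\upsilon)\le3s^{1/p}\,\frac{2\nu(H)+s^{-1}\upsilon}{1-2\kappa}.$$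
   Context: Observation model: $y=Ax+u+\sigma\xi\in\mathbb{R}^m$, where $x\in\mathbb{R}^n$ is unknown, $\xi\sim N(0,I_m)$, $\sigma>0$, and $u$ is an unknown nuisance from a known (nonempty) convex compact set $\mathcal{U}\subset\mathbb{R}^m$ symmetric with respect to the origin. $x^s$ is obtained from $x\in\mathbb{R}^n$ by zeroing all but the $s$ largest in magnitude entries (ties resolved in favour of smaller indices); $\|x\|_{s,q}=\|x^s\|_q$. $\nu_{\epsilon,\sigma,\mathcal{U}}(v)=\sup_{u\in\mathcal{U}}u^Tv+\sigma\sqrt{2\ln(n/\epsilon)}\|v\|_2$, a norm on $\mathbb{R}^m$. Condition $\mathbf{H}_{s,q}(\kappa)$ ($\kappa>0$) on $H\in\mathbb{R}^{m\times n}$: $\|x\|_{s,q}\le s^{1/q}\|H^TAx\|_\infty+\kappa s^{1/q-1}\|x\|_1$ for all $x\in\mathbb{R}^n$ (with $1/\infty=0$). Regular recovery (with $\rho_i>0$): $\widehat{x}_{\rm reg}(y)\in\mathrm{Argmin}_v\{\|v\|_1:|h_i^T(Av-y)|\le\rho_i,\ 1\le i\le n\}$ (value arbitrary for $y$ for which the problem is infeasible). Penalized recovery: $\widehat{x}_{\rm pen}(y)\in\mathrm{Argmin}_v\{\|v\|_1+\theta s\|H^T(Av-y)\|_\infty\}$. Both are taken to be Borel functions of $y$. $X(s,\upsilon)=\{x\in\mathbb{R}^n:\|x-x^s\|_1\le\upsilon\}$, and $$\mathrm{Risk}_p(\widehat{x}(\cdot)|\epsilon,\sigma,s,\upsilon)=\inf\{\delta:\mathrm{Prob}\{\xi:\exists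 x\in X(s,\upsilon),u\in\mathcal{U}:\|\widehat{x}(Ax+\sigma\xi+u)-x\|_p>\delta\}\le\epsilon\};$$ equivalently, $\mathrm{Risk}_p\le\delta$ iff there is a set $\Xi$ with $\mathrm{Prob}\{\xi\in\Xi\}\ge1-\epsilon$ such that $\|\widehat{x}(Ax+\sigma\xi+u)-x\|_p\le\delta$ for all $\xi\in\Xi$, $x\in X(s,\upsilon)$, $u\in\mathcal{U}$. *)

(* Defs.v *)
(* Vectors of R^n are columns, of type 'cV[R]_n. *)
From HB Require Import structures.
From mathcomp Require Import all_boot all_order all_algebra.
From mathcomp Require Import all_classical all_reals all_analysis.

Set Implicit Arguments.
Unset Strict Implicit.
Unset Printing Implicit Defensive.

Import Order.TTheory GRing.Theory Num.Theory.
Import numFieldNormedType.Exports.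

Local Open Scope classical_set_scope.
Local Open Scope ring_scope.

Section vectors.
Variable R : realType.

Definition dotv (k : nat) (u v : 'cV[R]_k) : R := \sum_(i < k) u i 0 * v i 0.

(* 1/p for p in [1, +oo], with 1/oo = 0 *)
Definition invp (p : \bar R) : R := fine (p^-1)%E.

(* only used for p in [1, +oo]; the value at -oo is a dummy *)
Definition lpnorm (p : \bar R) (k : nat) (x : 'cV[R]_k) : R :=
  match p with
  | r%:E%E => (\sum_(i < k) `|x i 0| `^ r) `^ r^-1
  | +oo%E => \big[Num.max/0]_(i < k) `|x i 0|
  | -oo%E => 0
  end.

(* number of entries that come before entry i when the entries are listed by
   decreasing magnitude, ties being resolved in favour of smaller indices *)
Definition mag_rank (k : nat) (x : 'cV[R]_k) (i : 'I_k) : nat :=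
  #|[set j : 'I_k | (`|x i 0| < `|x j 0|)
                    || ((`|x j 0| == `|x i 0|) && (j < i)%N)]|.

Definition best_approx (s k : nat) (x : 'cV[R]_k) : 'cV[R]_k :=
  \col_(i < k) (if (mag_rank x i < s)%N then x i 0 else 0).

Definition sqnorm (s : nat) (q : \bar R) (k : nat) (x : 'cV[R]_k) : R :=
  lpnorm q (best_approx s x).

Definition nearly_sparse (k s : nat) (upsilon : R) : set 'cV[R]_k :=
  [set x | lpnorm 1%:E (x - best_approx s x) <= upsilon].

End vectors.

Section recovery.
Variables (R : realType) (m n : nat).
Implicit Types (A H : 'M[R]_(m, n)) (U : set 'cV[R]_m).
Implicit Types (xhat : 'cV[R]_m -> 'cV[R]_n).

Definition uncertainty_set U : Prop :=
  [/\ U !=set0, convex_set U, compact U & forall u, U u -> U (- u)].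

Definition nu (eps sigma : R) U (v : 'cV[R]_m) : R :=
  sup [set dotv u v | u in U]
  + sigma * Num.sqrt (2 * ln (n%:R / eps)) * lpnorm 2%:E v.

(* the neutral element 0 is harmless: nu is nonnegative *)
Definition nu_max (eps sigma : R) U H : R :=
  \big[Num.max/0]_(i < n) nu eps sigma U (col i H).

Definition condH A (s : nat) (q : \bar R) (kappa : R) H : Prop :=
  forall x : 'cV[R]_n,
    sqnorm s q x <= s%:R `^ invp q * lpnorm +oo%E (H^T *m A *m x)
                    + kappa * s%:R `^ (invp q - 1) * lpnorm 1%:E x.

Definition borel_fun xhat : Prop :=
  measurable_fun setT
    (xhat : g_sigma_algebraType (@open 'cV[R]_m) ->
            g_sigma_algebraType (@open 'cV[R]_n)).

Definition reg_feasible A H (rho : 'I_n -> R) (y : 'cV[R]_m)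
    : set 'cV[R]_n :=
  [set v | forall i, `|dotv (col i H) (A *m v - y)| <= rho i].

Definition regular_recovery A H (rho : 'I_n -> R) xhat : Prop :=
  borel_fun xhat /\
  forall y, reg_feasible A H rho y !=set0 ->
    reg_feasible A H rho y (xhat y) /\
    forall v, reg_feasible A H rho y v ->
      lpnorm 1%:E (xhat y) <= lpnorm 1%:E v.

Definition pen_objective A H (s : nat) (theta : R) (y : 'cV[R]_m)
    (v : 'cV[R]_n) : R :=
  lpnorm 1%:E v + theta * s%:R * lpnorm +oo%E (H^T *m (A *m v - y)).

Definition penalized_recovery A H (s : nat) (theta : R) xhat : Prop :=
  borel_fun xhat /\
  forall y v, pen_objective A H s theta y (xhat y)
              <= pen_objective A H s theta y v.

Section risk.
Context (d : measure_display) (Omega : measurableType d).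
Variable P : probability Omega R.

(* xi ~ N(0, I_m): its law is the m-fold product of N(0, 1) *)
Definition std_gaussian (xi : Omega -> 'cV[R]_m) : Prop :=
  (forall i, measurable_fun setT (fun w => xi w i 0)) /\
  forall B : 'I_m -> set R, (forall i, measurable (B i)) ->
    P [set w | forall i, B i (xi w i 0)]
    = (\prod_(i < m) normal_prob 0 1 (B i))%E.

Definition bad_event A (sigma : R) U (s : nat) (upsilon : R) (p : \bar R)
    (xi : Omega -> 'cV[R]_m) xhat (delta : R) : set Omega :=
  [set w | exists x u, [/\ nearly_sparse s upsilon x, U u
    & delta < lpnorm p (xhat (A *m x + sigma *: xi w + u) - x)]].

(* The bad event is an uncountable union, in general measurable only for the
   completion of P; mu_ext P is the outer measure of P, which agrees with P on
   measurable sets and with its completion beyond them. *)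
Definition risk A (sigma : R) U (xi : Omega -> 'cV[R]_m) (p : \bar R) xhat
    (eps : R) (s : nat) (upsilon : R) : \bar R :=
  ereal_inf [set delta%:E | delta in [set delta : R |
    (mu_ext P (bad_event A sigma U s upsilon p xi xhat delta) <= eps%:E)%E]].

End risk.
End recovery.

Arguments nu {R m} n eps sigma U v.

(* Main.v *)
Require Import Defs.
From HB Require Import structures.
From mathcomp Require Import all_boot all_order all_algebra.
From mathcomp Require Import all_classical all_reals all_analysis.
From mathcomp Require Import measurable_realfun normal_distribution.
From mathcomp Require Import ring lra.

(** The argument splits into a probabilistic part, which isolates one
    favourable event, and a deterministic one, which bounds the error on
    that event.

    The favourable event is that, for each column [h] of [H], the number
    [dotv h xi] is at most [Num.sqrt (2 * ln (n / eps))] times the Euclidean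
    norm of [h] in absolute value. By rotation invariance [dotv h xi] is a
    standard normal variable scaled by the norm of [h] ([linear_form_law]),
    and a standard normal variable exceeds [t] in absolute value with
    probability at most [exp (- t^2 / 2)] ([normal_prob_tail]). So each
    column fails with probability at most [eps / n], and some column fails
    with probability at most [eps] ([large_noise_le]). On the event,
    [dotv h (sigma * xi + u)] is at most [nu h] in absolute value for all
    [u] in [U] simultaneously ([dotv_noise_le_nu]); hence it is enough to
    bound the recovery error for observations whose noise satisfies these
    inequalities ([risk_le]).

    For the deterministic part, let [z] be the error of the recovery, [I]
    the positions of the [s] largest entries of the signal [x], [g] the sup
    norm of [H^T A z], and [D] and [E] the l1 norms of [z] on and off [I],
    divided by [s]. The condition on [H] bounds the mean of order [q] of the
    [s] largest entries of [z] by [b = g + kappa (D + E)] ([condH_top]); in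
    particular [D <= b]. The optimality of the recovery yields a second
    linear inequality between [D], [E] and [g] ([error_off_support]), and
    since [2 kappa < 1] the two together bound [b] and [E]. Finally, the
    entries of [z] outside the [s] largest ones are at most [b], and their
    l1 norm is at most [s E], so that the p-th powers of the entries of [z]
    sum to at most [s (b + E) b^(p - 1)] ([lpnorm_le_top]).

    With [M] the fraction in the claimed bound, the regular recovery has
    [b <= M] and [E <= 2 M], and the sum is at most [3 s M^p]. The penalized
    recovery has [b + E <= 2 M], and the sum is at most [s (2 M)^p]. *)

Import Order.TTheory GRing.Theory Num.Theory.
Import numFieldNormedType.Exports.

Local Open Scope classical_set_scope.
Local Open Scope ring_scope.

Set Implicit Arguments.
Unset Strict Implicit.

(** * Affine images of the standard normal law *)

Section affine_gaussian.
Variable R : realType.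
Notation mu := (@lebesgue_measure R).
Notation N01 := (@normal_prob R 0 1).

Lemma measurable_affine (m s : R) :
  measurable_fun setT ((fun x => m + s * x) : R -> measurableTypeR R).
Proof. by apply: measurable_funD => //; apply: measurable_funM. Qed.

(** Lebesgue measure is determined by its values on intervals, and an affine
    bijection of slope [s] divides the length of an interval by [`|s|]. *)
Lemma lebesgue_measure_affine (m s : R) (A : set R) : s != 0 -> measurable A ->
  mu A = (`|s|%:E * mu ((fun x => m + s * x)%R @^-1` A))%E.
Proof.
move=> s0 mA.
pose r : {nonneg R} := NngNum (normr_ge0 s).
pose nu : {measure set (measurableTypeR R) -> \bar R} :=
  mscale r (pushforward mu ((fun x => m + s * x) : R -> measurableTypeR R)).
rewrite (_ : (_ * _)%E = nu (measurable_affine m s) A) //.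
apply: lebesgue_measure_unique => // _ [[a b] _ <-] /=.
rewrite /nu/= /mscale/= /pushforward.
have [sgt|slt|/eqP] := ltgtP s 0; last by rewrite (negbTE s0).
- rewrite (_ : _ @^-1` _ = `[(b - m) / s, (a - m) / s[%classic); last first.
    apply/seteqP; split=> x /=; rewrite !in_itv/= => /andP[h1 h2]; apply/andP;
      split.
    + by rewrite ler_ndivrMr //; lra.
    + by rewrite ltr_ndivlMr //; lra.
    + by move: h2; rewrite ltr_ndivlMr //; lra.
    + by move: h1; rewrite ler_ndivrMr //; lra.
  rewrite !lebesgue_measure_itv/= !lte_fin ltr_nM2r ?invr_lt0// ltrD2r.
  case: ifPn => _; last by rewrite mule0.
  by rewrite -EFinB -EFinB -EFinM; congr EFin; rewrite ltr0_norm//; field.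
- rewrite (_ : _ @^-1` _ = `](a - m) / s, (b - m) / s]%classic); last first.
    apply/seteqP; split=> x /=; rewrite !in_itv/= => /andP[h1 h2]; apply/andP;
      split.
    + by rewrite ltr_pdivrMr //; lra.
    + by rewrite ler_pdivlMr //; lra.
    + by move: h1; rewrite ltr_pdivrMr //; lra.
    + by move: h2; rewrite ler_pdivlMr //; lra.
  rewrite !lebesgue_measure_itv/= !lte_fin ltr_pM2r ?invr_gt0// ltrD2r.
  case: ifPn => _; last by rewrite mule0.
  by rewrite -EFinB -EFinB -EFinM; congr EFin; rewrite gtr0_norm//; field.
Qed.

(** The substitution [z = m + s * x] turns the standard density into the
    density of mean [m] and deviation [`|s|]; [normal_pdf] only sees [s]
    through its square, so [s] may be negative. *)
Lemma normal_pdf_affine (m s x : R) : s != 0 ->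
  normal_pdf 0 1 x = `|s| * normal_pdf m s (m + s * x).
Proof.
move=> s0; rewrite !normal_pdfE ?oner_neq0// mulrA; congr (_ * _).
  have E (t : R) : Num.sqrt (t ^+ 2 * pi *+ 2) = `|t| * Num.sqrt (pi *+ 2).
    by rewrite -mulrnAr sqrtrM ?sqr_ge0// sqrtr_sqr.
  rewrite /normal_peak !E normr1 mul1r.
  by rewrite invfM mulrA mulfV ?normr_eq0// mul1r.
rewrite /normal_fun; congr expR; field; exact: s0.
Qed.

Lemma normal_prob_affine (m s : R) (C : set R) : s != 0 -> measurable C ->
  N01 ((fun x => m + s * x) @^-1` C) = normal_prob m s C.
Proof.
move=> s0 mC; rewrite /normal_prob.
pose r : {nonneg R} := NngNum (normr_ge0 s).
pose f := (fun x => m + s * x) : R -> measurableTypeR R.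
have mf : measurable_fun setT f by exact: measurable_affine.
pose nu : {measure set (measurableTypeR R) -> \bar R} :=
  mscale r (pushforward mu f).
have mpdf : measurable_fun C (fun x : measurableTypeR R =>
    (normal_pdf m s x)%:E).
  apply/measurable_EFinP; apply: measurable_funTS.
  exact: measurable_normal_pdf.
transitivity (\int[nu mf]_(x in C) (normal_pdf m s x)%:E)%E; last first.
  apply: eq_measure_integral => A mA _.
  exact/esym/(@lebesgue_measure_affine m s).
rewrite ge0_integral_mscale//=; last first.
  by move=> x _; rewrite lee_fin normal_pdf_ge0.
rewrite ge0_integral_pushforward//=; last first.
  by move=> x _; rewrite lee_fin normal_pdf_ge0.
rewrite -ge0_integralZl//=.
- by apply: eq_integral => x _; rewrite (@normal_pdf_affine m s).
- by rewrite -[X in measurable X]setTI; exact: mf.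
- apply/measurable_EFinP; apply: measurable_funTS.
  by apply: measurableT_comp => //; exact: measurable_normal_pdf.
- by move=> x _; rewrite lee_fin normal_pdf_ge0.
Qed.

(** The density is the Radon-Nikodym derivative of the law, up to a null set. *)
Lemma integral_normal_prob (m s : R) (f : R -> \bar R) :
  measurable_fun setT f ->
  (\int[normal_prob m s]_x `|f x| < +oo)%E ->
  (\int[normal_prob m s]_x f x = \int[mu]_x (f x * (normal_pdf m s x)%:E))%E.
Proof.
move=> mf finf.
have dom := normal_prob_dominates m s.
rewrite -(Radon_Nikodym_change_of_variables dom)//=; last first.
  by apply/integrableP; split.
have mpdf : measurable_fun setT (fun x : measurableTypeR R =>
    (normal_pdf m s x)%:E).
  by apply/measurable_EFinP; exact: measurable_normal_pdf.
apply: ae_eq_integral => //.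
- apply: emeasurable_funM; first exact: mf.
  by apply: (measurable_int mu); exact: Radon_Nikodym_integrable.
- by apply: emeasurable_funM; [exact: mf|exact: mpdf].
- set g := Radon_Nikodym _ _.
  suff : ae_eq mu setT g (fun x => (normal_pdf m s x)%:E).
    by apply: filterS => x /= /[apply] ->.
  rewrite /g Radon_NikodymE//=.
  case: cid => /= h [h1 h2 h3].
  apply: integral_ae_eq => //=.
  by move=> E E01 mE; rewrite -h3.
Qed.

End affine_gaussian.

(** * Rotation invariance *)

Section rotation.
Variable R : realType.
Notation mu := (@lebesgue_measure R).
Notation N01 := (@normal_prob R 0 1).

Lemma normal_prob_setT : N01 [set: R] = 1%E.
Proof. exact: (probability_setT (normal_prob 0 1)). Qed.

Lemma measurable_sum2 (a b : R) (C : set R) : measurable C ->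
  measurable [set z : measurableTypeR R * measurableTypeR R |
    C (a * z.1 + b * z.2)].
Proof.
move=> mC; rewrite -[X in measurable X]setTI.
have mf : measurable_fun setT
    (fun z : measurableTypeR R * measurableTypeR R => a * z.1 + b * z.2).
  by apply: measurable_funD; apply: measurable_funM.
exact: mf.
Qed.

Lemma normal_pdf_sqr (m s t : R) : s ^+ 2 = t ^+ 2 ->
  normal_pdf m s = normal_pdf m t.
Proof.
move=> st; have st0 : (s == 0) = (t == 0).
  by rewrite -[s == 0]sqrf_eq0 -[t == 0]sqrf_eq0 st.
by apply/funext => x; rewrite /normal_pdf /normal_peak /normal_fun st st0.
Qed.

(** Both sides are the joint density of two standard normal variables [x]
    and [z] of correlation [c], disintegrated along [x] on the left and
    along [z] on the right. In the exponents this is the symmetry in [x] and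
    [z] of [x ^+ 2 + ((z - c * x) / s) ^+ 2] when [c ^+ 2 + s ^+ 2 = 1]. *)
Lemma normal_pdf_swap (c s x z : R) : c ^+ 2 + s ^+ 2 = 1 -> s != 0 ->
  normal_pdf 0 1 x * normal_pdf (c * x) s z =
  normal_pdf 0 1 z * normal_pdf (c * z) s x.
Proof.
move=> cs s0; rewrite !normal_pdfE ?oner_neq0//.
rewrite mulrACA [RHS]mulrACA; congr (_ * _); rewrite /normal_fun -!expRD.
congr expR; apply: (@mulIf _ (s ^+ 2 *+ 2)).
  by rewrite mulrn_eq0/= sqrf_eq0.
rewrite !mulrDl !mulfVK ?mulrn_eq0/= ?sqrf_eq0//.
have -> : s ^+ 2 = 1 - c ^+ 2 by rewrite -cs addrAC subrr add0r.
by field.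
Qed.

(** Given [x], the variable [c * x + s * y] is normal with mean [c * x] and
    deviation [`|s|]. The law of the sum is the mixture of these laws over
    [x]; after exchanging the order of integration and swapping the roles of
    [x] and [z] in the joint density, the inner integral is that of a
    density, hence 1. *)
Lemma normal_prob_rotation (c s : R) (C : set R) : c ^+ 2 + s ^+ 2 = 1 ->
  measurable C ->
  (N01 \x N01)%E [set z | C (c * z.1 + s * z.2)] = N01 C.
Proof.
move=> cs mC.
have mZ := measurable_sum2 c s mC.
(* For s = 0 the pair collapses to its first coordinate, up to a sign. *)
have [s0|s0] := eqVneq s 0.
  have c1 : c ^+ 2 = 1 by rewrite -cs s0 expr0n/= addr0.
  have c0 : c != 0 by rewrite -sqrf_eq0 c1 oner_eq0.
  rewrite (_ : [set _ | _] = (fun x => 0 + c * x) @^-1` C `*` setT); last first.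
    apply/seteqP; split => -[x y]/=; rewrite s0 mul0r addr0 add0r => //.
    by case.
  rewrite product_measure1E//; last first.
    by rewrite -[X in measurable X]setTI; exact: measurable_affine.
  rewrite /= normal_prob_setT mule1.
  transitivity (normal_prob 0 c C); first exact: normal_prob_affine.
  rewrite /normal_prob.
  by rewrite (@normal_pdf_sqr _ c 1)// c1 expr1n.
have secE x : N01 (xsection [set z : R * R | C (c * z.1 + s * z.2)] x) =
    normal_prob (c * x) s C.
  transitivity (N01 ((fun y => c * x + s * y) @^-1` C));
    last exact: normal_prob_affine.
  apply: (f_equal N01).
  by apply/seteqP; split => y; rewrite /xsection/= ?inE.
transitivity (\int[N01]_x normal_prob (c * x) s C)%E.
  by apply: eq_integral => x _; rewrite -secE.
have mg : measurable_fun setT (fun x : R => normal_prob (c * x) s C).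
  rewrite (_ : (fun x : R => _) = (fun x =>
      N01 (xsection [set z : R * R | C (c * z.1 + s * z.2)] x))).
    exact: (@measurable_fun_xsection _ _ _ _ _ (normal_prob 0 1) _ mZ).
  by apply/funext => x; rewrite secE.
rewrite integral_normal_prob//; last 1 first.
  apply: (@le_lt_trans _ _ (\int[N01]_x (cst 1%E x))%E); last first.
    by rewrite integral_cst//= mul1e normal_prob_setT ltry.
  apply: ge0_le_integral => //=.
  - exact: measurableT_comp.
  - by move=> x _; rewrite gee0_abs//; exact: probability_le1.
pose F (p : measurableTypeR R * measurableTypeR R) : \bar R :=
  (normal_pdf 0 1 p.1 * normal_pdf (c * p.1) s p.2 * \1_C p.2)%:E.
have mF : measurable_fun setT F.
  apply/measurable_EFinP; apply: measurable_funM; last first.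
    exact: measurableT_comp (measurable_indic mC) measurable_snd.
  apply: measurable_funM.
    exact: measurableT_comp (measurable_normal_pdf 0 1) measurable_fst.
  rewrite (_ : (fun p => _) = (fun p : measurableTypeR R * measurableTypeR R =>
      normal_peak s * expR (- (p.2 - c * p.1) ^+ 2 / (s ^+ 2 *+ 2)))).
    apply: measurable_funM => //; apply: measurableT_comp => //.
    apply: measurable_funM => //; apply: measurableT_comp => //.
    apply: measurable_funX; apply: measurable_funB => //.
    exact: measurable_funM.
  by apply/funext => p; rewrite normal_pdfE.
have F0 p : (0 <= F p)%E.
  by rewrite lee_fin !mulr_ge0// ?normal_pdf_ge0// indicE ler0n.
transitivity (\int[mu]_x \int[mu]_z F (x, z))%E.
  apply: eq_integral => x _; rewrite muleC /normal_prob integral_mkcond.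
  rewrite -ge0_integralZl//=.
  - apply: eq_integral => z _; rewrite /F patchE indicE/=.
    by case: ifPn => _; rewrite ?mulr1 ?mulr0 ?mule0.
  - apply/(measurable_restrictT _ mC)/measurable_EFinP; apply: measurable_funTS.
    exact: measurable_normal_pdf.
  - by move=> z _; rewrite patchE; case: ifPn => // _;
      rewrite lee_fin normal_pdf_ge0.
  - by rewrite lee_fin normal_pdf_ge0.
rewrite fubini_tonelli//.
rewrite /normal_prob [RHS]integral_mkcond.
apply: eq_integral => z _.
rewrite (_ : (fun x : R => _) =
    (fun x => (normal_pdf 0 1 z * \1_C z)%:E * (normal_pdf (c * z) s x)%:E)%E);
  last by apply/funext => x; rewrite /F/= normal_pdf_swap// mulrAC.
rewrite ge0_integralZl//=.
- rewrite integral_normal_pdf mule1 patchE indicE/=.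
  by case: ifPn => _; rewrite ?mulr1 ?mulr0.
- by apply/measurable_EFinP; exact: measurable_normal_pdf.
- by move=> x _; rewrite lee_fin normal_pdf_ge0.
- by rewrite lee_fin mulr_ge0// normal_pdf_ge0.
Qed.
End rotation.

(** * Linear forms of a standard Gaussian vector *)

Section law.
Variable R : realType.
Notation N01 := (@normal_prob R 0 1).

Lemma measurable_preimage_scale (a : R) (C : set R) : measurable C ->
  measurable ((fun x => a * x) @^-1` C).
Proof.
move=> mC; rewrite -[X in measurable X]setTI.
have : measurable_fun setT (fun x : R => a * x) by exact: measurable_funM.
exact.
Qed.

(** Dividing by [Num.sqrt (a ^+ 2 + b ^+ 2)] reduces this to a rotation. *)
Lemma normal_prob_sum2 (a b : R) (C : set R) : measurable C ->
  (N01 \x N01)%E [set z | C (a * z.1 + b * z.2)] =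
  N01 ((fun x => Num.sqrt (a ^+ 2 + b ^+ 2) * x) @^-1` C).
Proof.
move=> mC; set r := Num.sqrt _.
have r2 : r ^+ 2 = a ^+ 2 + b ^+ 2 by rewrite sqr_sqrtr// addr_ge0 ?sqr_ge0.
have [r0|r0] := eqVneq r 0.
  move: r2; rewrite r0 expr0n/= => /esym/eqP.
  rewrite paddr_eq0 ?sqr_ge0// !sqrf_eq0 => /andP[/eqP-> /eqP->].
  have [C0|C0] := pselect (C 0).
    rewrite (_ : [set _ | _] = setT `*` setT); last first.
      by apply/seteqP; split => -[x y]//= _; rewrite !mul0r addr0.
    rewrite product_measure1E//= (_ : _ @^-1` _ = setT); last first.
      by apply/seteqP; split => x//= _; rewrite mul0r.
    by rewrite normal_prob_setT mule1.
  rewrite (_ : [set _ | _] = set0); last first.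
    by apply/seteqP; split => -[x y]//=; rewrite !mul0r addr0.
  rewrite (_ : _ @^-1` _ = set0) ?measure0//.
  by apply/seteqP; split => x//=; rewrite mul0r.
rewrite -(@normal_prob_rotation _ (a / r) (b / r)); last 2 first.
- by rewrite !expr_div_n -mulrDl -r2 divff// sqrf_eq0.
- exact: measurable_preimage_scale.
apply: f_equal; apply/seteqP; split => -[x y]/=; congr (C _); by field.
Qed.

(** The law of a pair with independent normal coordinates, [nu], is only
    known on rectangles. It is the product of its marginals because a
    measure on a product is determined there; the first marginal [L] is the
    image of a standard normal law under scaling by [a], which also makes
    [nu] the image of the standard normal law of the plane under scaling the
    first coordinate. *)
Lemma normal_prob_sum_of_rectangles
    (nu : {measure set (measurableTypeR R * measurableTypeR R) -> \bar R})
    (a h : R) :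
  (forall A D : set R, measurable A -> measurable D ->
    nu (A `*` D) = (N01 ((fun x => a * x)%R @^-1` A) * N01 D)%E) ->
  forall C : set R, measurable C ->
  nu [set z | C (z.1 + h * z.2)] =
  N01 ((fun x => Num.sqrt (a ^+ 2 + h ^+ 2) * x) @^-1` C).
Proof.
move=> nuE C mC.
pose f (x : measurableTypeR R) : measurableTypeR R := a * x.
have ma : measurable_fun setT f by exact: measurable_funM.
pose L0 : {measure set (measurableTypeR R) -> \bar R} :=
  pushforward (normal_prob 0 1) f.
have L1 : L0 ma setT = 1%E by exact: normal_prob_setT.
pose L : probability (measurableTypeR R) R :=
  HB.pack (Measure.sort (L0 ma)) (Measure_isProbability.Build _ _ _ (L0 ma) L1).
have := measurable_sum2 1 h mC; under eq_set do rewrite mul1r.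
move=> mZ; rewrite -normal_prob_sum2//.
pose g (z : measurableTypeR R * measurableTypeR R) :
  measurableTypeR R * measurableTypeR R := (a * z.1, z.2).
have mg : measurable_fun setT g.
  by apply/measurable_fun_pair => //=; exact: measurable_funM.
pose nu2 : {measure set (measurableTypeR R * measurableTypeR R) -> \bar R} :=
  pushforward (normal_prob 0 1 \x normal_prob 0 1)%E g.
transitivity ((L \x normal_prob 0 1)%E [set z | C (z.1 + h * z.2)]).
  by apply/esym; apply: product_measure_unique => // A D mA mD; exact: nuE.
transitivity (nu2 mg [set z | C (z.1 + h * z.2)]); last by [].
apply: product_measure_unique => // A D mA mD.
rewrite /nu2/= /pushforward.
rewrite (_ : _ @^-1` _ = (fun x => a * x) @^-1` A `*` D)//.
by rewrite product_measure1E//; exact: measurable_preimage_scale.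
Qed.

Section standard_gaussian_vector.
Variables (d : measure_display) (Omega : measurableType d).
Variables (P : probability Omega R) (m : nat) (xi : Omega -> 'cV[R]_m).
Hypothesis xiN : std_gaussian P xi.

Lemma measurable_linear_form (h : 'cV[R]_m) (Q : pred 'I_m) :
  measurable_fun setT (fun w => \sum_(i < m | Q i) h i 0 * xi w i 0).
Proof.
under eq_fun do rewrite big_mkcond.
apply: measurable_sum => i; case: (Q i) => //.
by apply: measurable_funM => //; exact: xiN.1.
Qed.

Lemma measurable_coordinates (B : 'I_m -> set R) :
  (forall i, measurable (B i)) ->
  measurable [set w | forall i, B i (xi w i 0)].
Proof.
move=> mB; rewrite (_ : [set _ | _] =
    \bigcap_(i in [set: 'I_m]) ((fun w => xi w i 0) @^-1` B i)); last first.
  by apply/seteqP; split => w /= H i; [move=> _|]; exact: H.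
apply: fin_bigcap_measurable => // i _.
by rewrite -[X in measurable X]setTI; exact: xiN.1.
Qed.

(** The coordinates enter the sum one at a time. Keeping the events [B i] on
    the remaining coordinates in the statement carries the independence of
    the partial sum from them through the induction, with no separate notion
    of independence. Setting [B i = setT] for the coordinates already summed
    lets a single product range over all of them. *)
Lemma partial_linear_form_law (h : 'cV[R]_m) (k : nat) (C : set R)
    (B : 'I_m -> set R) :
  (k <= m)%N -> measurable C -> (forall i, measurable (B i)) ->
  (forall i : 'I_m, (i < k)%N -> B i = setT) ->
  P [set w | C (\sum_(i < m | (i < k)%N) h i 0 * xi w i 0) /\
             forall i, B i (xi w i 0)] =
  (N01 ((fun x => Num.sqrt (\sum_(i < m | (i < k)%N) h i 0 ^+ 2) * x)%R @^-1` C)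
   * \prod_(i < m) N01 (B i))%E.
Proof.
elim: k C B => [|k IH] C B km mC mB BT.
  rewrite (big_pred0 _ _ _ _ (fun i : 'I_m => ltn0 i)) sqrtr0.
  under eq_set do rewrite (big_pred0 _ _ _ _ (fun i : 'I_m => ltn0 i)).
  have [C0|C0] := pselect (C 0).
    rewrite (_ : _ @^-1` _ = setT); last first.
      by apply/seteqP; split => x//= _; rewrite mul0r.
    rewrite normal_prob_setT mul1e -xiN.2//.
    by apply: f_equal; apply/seteqP; split => w//= -[].
  rewrite (_ : [set _ | _] = set0); last first.
    by apply/seteqP; split => w //= -[].
  rewrite (_ : _ @^-1` _ = set0) ?measure0 ?mul0e//.
  by apply/seteqP; split => x//=; rewrite mul0r.
pose j := Ordinal km.
have sumk (F : 'I_m -> R) :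
    \sum_(i < m | (i < k.+1)%N) F i = \sum_(i < m | (i < k)%N) F i + F j.
  rewrite (bigD1 j)//= addrC; congr (_ + _); apply: eq_bigl => i.
  by rewrite ltnS ltn_neqAle andbC.
pose E0 := [set w | forall i, B i (xi w i 0)].
have mE0 : measurable E0 by exact: measurable_coordinates.
set c := (\prod_(i < m) N01 (B i))%E.
have PE0 : P E0 = c by exact: xiN.2.
pose S w := \sum_(i < m | (i < k)%N) h i 0 * xi w i 0.
pose g w : measurableTypeR R * measurableTypeR R := (S w, xi w j 0).
have mg : measurable_fun setT g.
  by apply/measurable_fun_pair; [exact: measurable_linear_form|exact: xiN.1].
set a := Num.sqrt (\sum_(i < m | (i < k)%N) h i 0 ^+ 2).
(* On E0, the pair (partial sum, next coordinate) has c times a product law: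
   the event D on coordinate j is absorbed in B. *)
have rect (A D : set R) : measurable A -> measurable D ->
    P (g @^-1` (A `*` D) `&` E0) =
    (N01 ((fun x => a * x)%R @^-1` A) * N01 D * c)%E.
  move=> mA mD.
  pose B' i := if i == j then D else B i.
  rewrite (_ : _ `&` _ = [set w | A (S w) /\ forall i, B' i (xi w i 0)]).
  2: {
    apply/seteqP; split => w /=.
      move=> [[AS Dj] Bi]; split => // i; rewrite /B'; case: eqVneq => [->//|_].
      exact: Bi.
    move=> [AS Bi]; split; first by split => //; have := Bi j; rewrite /B' eqxx.
    move=> i; have := Bi i; rewrite /B'; case: eqVneq => [-> _|//].
    by rewrite BT//=.
  }
  rewrite IH//; last 3 first.
  - exact: ltnW.
  - by move=> i; rewrite /B'; case: ifP.
  - move=> i ik; rewrite /B'; case: eqVneq => [ij|_].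
      by move: ik; rewrite ij ltnn.
    by rewrite BT// ltnW.
  rewrite -muleA; congr (_ * _)%E.
  rewrite /c (bigD1 j)//= [in RHS](bigD1 j)//=.
  rewrite {1}/B' eqxx (BT j)//= normal_prob_setT mul1e; congr (_ * _)%E.
  by apply: eq_bigr => i ij; rewrite /B' (negbTE ij).
have cfin : c \is a fin_num by rewrite -PE0 fin_num_measure.
have c0 : (0 <= fine c)%R by rewrite -PE0 fine_ge0.
(* If c = 0 then E0 is negligible; otherwise dividing by c normalizes the law
   of the pair to a probability. *)
have [c00|c00] := eqVneq (fine c) 0.
  have -> : c = 0%E by rewrite -(fineK cfin) c00.
  rewrite mule0; apply/eqP; rewrite eq_le measure_ge0 andbT.
  have <- : P E0 = 0%E by rewrite PE0 -(fineK cfin) c00.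
  apply: le_measure; rewrite ?inE//; last by move=> w [].
  apply: measurableI => //; rewrite -[X in measurable X]setTI.
  exact: measurable_linear_form.
rewrite (_ : [set _ | _] = g @^-1` [set z | C (z.1 + h j 0 * z.2)] `&` E0);
  last by apply/seteqP; split => w /=; rewrite sumk.
have c1 : (0 <= (fine c)^-1)%R by rewrite invr_ge0.
pose r : {nonneg R} := NngNum c1.
pose nu : {measure set (measurableTypeR R * measurableTypeR R) -> \bar R} :=
  mscale r (pushforward (mrestr P mE0) g).
have nuE : forall A D : set R, measurable A -> measurable D ->
    nu mg (A `*` D) = (N01 ((fun x => a * x)%R @^-1` A) * N01 D)%E.
  move=> A D mA mD; rewrite /nu/= /mscale/= /pushforward /mrestr rect//.
  by rewrite muleCA -(fineK cfin) -EFinM mulVf// mule1.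
have a2 : a ^+ 2 = \sum_(i < m | (i < k)%N) h i 0 ^+ 2.
  by rewrite sqr_sqrtr// sumr_ge0// => i _; exact: sqr_ge0.
rewrite sumk -a2 -(@normal_prob_sum_of_rectangles (nu mg) a (h j 0) nuE)//.
rewrite /nu/= /mscale/= /pushforward /mrestr -{2}(fineK cfin).
by rewrite muleAC -EFinM mulVf// mul1e.
Qed.

End standard_gaussian_vector.
End law.

(** * Gaussian tails *)

Section tail.
Variable R : realType.
Notation N01 := (@normal_prob R 0 1).

(** Shifting a Gaussian away from the side on which [D] lies costs
    [expR (- (c ^+ 2 / 2))], because [(y + c) ^+ 2 >= y ^+ 2 + c ^+ 2] when
    [c * y >= 0]. *)
Lemma normal_prob_shift_le (c : R) (D : set R) : measurable D ->
  (forall y, D y -> 0 <= c * y) ->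
  (normal_prob (- c) 1 D <= (expR (- (c ^+ 2 / 2)))%:E * N01 D)%E.
Proof.
move=> mD cD; rewrite /normal_prob.
have mpdf (m : R) : measurable_fun D (fun x : measurableTypeR R =>
    (normal_pdf m 1 x)%:E).
  apply/measurable_EFinP; apply: measurable_funTS; exact: measurable_normal_pdf.
rewrite -ge0_integralZl//=; last 2 first.
- exact: mpdf.
- by move=> x _; rewrite lee_fin normal_pdf_ge0.
apply: ge0_le_integral => //=.
- by move=> x _; rewrite lee_fin normal_pdf_ge0.
- exact: mpdf.
- by apply: measurable_funeM; exact: mpdf.
move=> y Dy; rewrite -EFinM lee_fin !normal_pdfE ?oner_neq0//.
rewrite mulrCA ler_wpM2l ?normal_peak_ge0//.
rewrite /normal_fun -expRD ler_expR; have := cD _ Dy.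
rewrite opprK subr0 expr1n; lra.
Qed.

(** The two tails are shifts of the two half-lines, so together they have at
    most [expR (- (t ^+ 2 / 2))] times the mass of the line. There is no
    factor 2 in front, and this is what makes the union bound below close
    exactly at [eps]. *)
Lemma normal_prob_tail (t : R) : 0 <= t ->
  (N01 [set x | (t < `|x|)%R] <= (expR (- (t ^+ 2 / 2)))%:E)%E.
Proof.
move=> t0.
pose U : set R := [set y | 0 < y]; pose V : set R := [set y | y < 0].
have mU : measurable U.
  rewrite (_ : U = `]0, +oo[%classic)//.
  by apply/seteqP; split => x; rewrite /U/= in_itv/= andbT.
have mV : measurable V.
  by rewrite (_ : V = `]-oo, 0[%classic).
have -> : [set x | (t < `|x|)%R] =
    (fun x => - t + 1 * x) @^-1` U `|` (fun x => - - t + 1 * x) @^-1` V.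
  apply/seteqP; split => x; rewrite /U/V/= mul1r opprK ltr_normr.
    by move=> /orP[h|h]; [left|right]; lra.
  by move=> [h|h]; apply/orP; [left|right]; lra.
have mpre (m : R) (D : set R) : measurable D ->
    measurable ((fun x => m + 1 * x) @^-1` D : set R).
  by move=> mD; rewrite -[X in measurable X]setTI; exact: measurable_affine.
set e := expR _.
have NU : (N01 ((fun x => - t + 1 * x)%R @^-1` U) <= e%:E * N01 U)%E.
  rewrite normal_prob_affine ?oner_neq0//; apply: normal_prob_shift_le => // y.
  by rewrite /U/= => y0; nra.
have NV : (N01 ((fun x => - - t + 1 * x)%R @^-1` V) <= e%:E * N01 V)%E.
  rewrite normal_prob_affine ?oner_neq0// /e -(sqrrN t).
  by apply: normal_prob_shift_le => // y; rewrite /V/= => y0; nra.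
apply: (@le_trans _ _ (e%:E * N01 U + e%:E * N01 V)%E).
  by apply: le_trans (leeD NU NV); apply: measureU2; exact: mpre.
rewrite -ge0_muleDr ?measure_ge0//.
rewrite -[leRHS]mule1; apply: lee_wpmul2l; first by rewrite lee_fin expR_ge0.
have <- : N01 (U `|` V) = (N01 U + N01 V)%E.
  apply: measureU => //; apply/seteqP; split => x //=.
  by rewrite /U/V/= => -[x0 /(lt_trans x0)]; rewrite ltxx.
by apply: probability_le1; exact: measurableU.
Qed.
End tail.

Section noise.
Variables (R : realType) (d : measure_display) (Omega : measurableType d).
Variables (P : probability Omega R) (m : nat) (xi : Omega -> 'cV[R]_m).
Hypothesis xiN : std_gaussian P xi.
Notation N01 := (@normal_prob R 0 1).

Lemma lpnorm2E (k : nat) (x : 'cV[R]_k) :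
  lpnorm 2%:E x = Num.sqrt (\sum_(i < k) x i 0 ^+ 2).
Proof.
rewrite /lpnorm powR12_sqrt; last by rewrite sumr_ge0// => i _; exact: powR_ge0.
congr Num.sqrt; apply: eq_bigr => i _.
by rewrite powR_mulrn// real_normK// num_real.
Qed.

Lemma measurable_dotv (h : 'cV[R]_m) :
  measurable_fun setT (fun w => dotv h (xi w)).
Proof. exact: (measurable_linear_form xiN h predT). Qed.

(** The case [k = m] of the partial sums, in which no condition is left on
    the coordinates. *)
Lemma linear_form_law (h : 'cV[R]_m) (C : set R) : measurable C ->
  P [set w | C (dotv h (xi w))] =
  N01 ((fun x => lpnorm 2%:E h * x) @^-1` C).
Proof.
move=> mC.
have := @partial_linear_form_law _ _ _ P _ _ xiN h m C (fun=> setT) (leqnn m) mC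
  (fun=> measurableT) (fun _ _ => erefl).
have E (F : 'I_m -> R) : \sum_(i < m | (i < m)%N) F i = \sum_(i < m) F i.
  by apply: eq_bigl => i; rewrite ltn_ord.
rewrite E -lpnorm2E big1 ?mule1; last by move=> i _; exact: normal_prob_setT.
move=> <-; apply: f_equal; apply/seteqP; split => w /=; rewrite E;
  [by []|by case].
Qed.

Lemma measurable_norm_gt (t : R) : measurable [set x : R | t < `|x|].
Proof.
have mn : measurable_fun setT (fun x : R => `|x|) by exact: normr_measurable.
rewrite (_ : [set _ | _] = setT `&` (fun x : R => `|x|) @^-1` `]t, +oo[).
  by apply: mn.
by rewrite setTI; apply/seteqP; split => x /=; rewrite in_itv/= andbT.
Qed.

Lemma measurable_dotv_gt (h : 'cV[R]_m) (t : R) :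
  measurable [set w | t < `|dotv h (xi w)|].
Proof.
rewrite (_ : [set _ | _] =
    setT `&` (fun w => dotv h (xi w)) @^-1` [set x : R | t < `|x|]).
  by apply: measurable_dotv => //; exact: measurable_norm_gt.
by rewrite setTI.
Qed.

Lemma dotv_tail (h : 'cV[R]_m) (t : R) : 0 <= t ->
  (P [set w | (t * lpnorm 2%:E h < `|dotv h (xi w)|)%R]
   <= (expR (- (t ^+ 2 / 2)))%:E)%E.
Proof.
move=> t0; set a := lpnorm 2%:E h.
have a0 : 0 <= a by rewrite /a lpnorm2E sqrtr_ge0.
have mC := measurable_norm_gt (t * a).
rewrite (linear_form_law h mC) -/a.
have [a00|a00] := eqVneq a 0.
  rewrite (_ : _ @^-1` _ = set0) ?measure0 ?lee_fin ?expR_ge0//.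
  by apply/seteqP; split => x //=; rewrite a00 mulr0 mul0r normr0 ltxx.
apply: le_trans (normal_prob_tail t0).
rewrite (_ : _ @^-1` _ = [set x | t < `|x|])//.
by apply/seteqP; split => x /=;
  rewrite normrM ger0_norm// mulrC ltr_pM2l// lt_def a0 a00.
Qed.

Lemma measurable_large_noise (n : nat) (H : 'M[R]_(m, n)) (t : R) :
  measurable [set w | exists i : 'I_n,
    t * lpnorm 2%:E (col i H) < `|dotv (col i H) (xi w)|].
Proof.
rewrite (_ : [set _ | _] = \bigcup_(i in [set: 'I_n])
    [set w | t * lpnorm 2%:E (col i H) < `|dotv (col i H) (xi w)|]).
  by apply: fin_bigcup_measurable => // i _; exact: measurable_dotv_gt.
by apply/seteqP; split => w [i]; [exists i | exists i].
Qed.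

(** The level is chosen so that each column contributes [eps / n] to the
    union bound. *)
Lemma large_noise_le (n : nat) (H : 'M[R]_(m, n)) (eps : R) :
  0 < eps -> eps < 1 ->
  (P [set w | exists i : 'I_n,
    (Num.sqrt (2 * ln (n%:R / eps)) * lpnorm 2%:E (col i H)
     < `|dotv (col i H) (xi w)|)%R] <= eps%:E)%E.
Proof.
move=> eps0 eps1; set t := Num.sqrt _.
case: n H @t => [|n] H t.
  rewrite (_ : [set _ | _] = set0) ?measure0 ?lee_fin ?ltW//.
  by apply/seteqP; split => w // -[[]].
pose F i := [set w | t * lpnorm 2%:E (col i H) < `|dotv (col i H) (xi w)|].
have mF i : measurable (F i) by exact: measurable_dotv_gt.
have PF i : (P (F i) <= (eps / n.+1%:R)%:E)%E.
  apply: (le_trans (dotv_tail _ _)); first exact: sqrtr_ge0.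
  have e1 : 1 <= n.+1%:R / eps.
    by rewrite ler_pdivlMr// mul1r (le_trans (ltW eps1))// ler1n.
  rewrite sqr_sqrtr; last by rewrite mulr_ge0// ln_ge0.
  by rewrite mulrC mulKf// expRN lnK ?invf_div// posrE divr_gt0.
have mX := measurable_large_noise H (Num.sqrt (2 * ln (n.+1%:R / eps))).
apply: (@le_trans _ _ (\sum_(i < n.+1) P (F (inord i)))%E).
  apply: (@content_subadditive _ _ _ P _ (fun k => F (inord k))) => //.
  move=> w [i Fi]; rewrite -(bigcup_mkord n.+1 (fun k => F (inord k))).
  by exists i => //=; rewrite inord_val.
apply: (@le_trans _ _ (\sum_(i < n.+1) (eps / n.+1%:R)%:E)%E).
  by apply: lee_sum => i _; exact: PF.
by rewrite sumEFin sumr_const card_ord lee_fin -[leLHS]mulr_natr divfK.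
Qed.

End noise.

(** * The entries of largest magnitude *)

Section top_entries.
Variables (R : realType) (n : nat).
Implicit Types (x : 'cV[R]_n) (i j l : 'I_n).

(** The strict total order that [mag_rank] counts along. *)
Definition precedes x j i : bool :=
  (`|x i 0| < `|x j 0|) || ((`|x j 0| == `|x i 0|) && (j < i)%N).

Lemma precedes_irr x i : precedes x i i = false.
Proof. by rewrite /precedes ltxx ltnn andbF. Qed.

Lemma precedes_trans x j i l :
  precedes x i j -> precedes x j l -> precedes x i l.
Proof.
rewrite /precedes => /orP[h1|/andP[/eqP e1 h1]] /orP[h2|/andP[/eqP e2 h2]].
- by rewrite (lt_trans h2 h1).
- by rewrite -e2 h1.
- by rewrite e1 h2.
- by rewrite e1 e2 eqxx (ltn_trans h1 h2) orbT.
Qed.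

Lemma precedes_total x i j : i != j -> precedes x i j || precedes x j i.
Proof.
move=> ij; rewrite /precedes.
have [h|h|h] := ltgtP `|x i 0| `|x j 0|; rewrite ?orbT//=.
by move: ij; rewrite -val_eqE neq_ltn.
Qed.

(** [mag_rank] is the cardinal of a classical set; the finite-type lemmas
    need it as the cardinal of a boolean predicate. *)
Lemma mag_rankE x i : mag_rank x i = #|[pred j | precedes x j i]|.
Proof.
by apply: eq_card => j; apply/idP/idP => [/set_mem|h]; [|exact: mem_set].
Qed.

Lemma mag_rank_lt x i j : precedes x i j -> (mag_rank x i < mag_rank x j)%N.
Proof.
move=> ij; rewrite !mag_rankE; apply: proper_card; apply/fintype.properP; split.
  by apply/fintype.subsetP => l; rewrite !inE => /precedes_trans; exact.
by exists i; rewrite !inE// precedes_irr.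
Qed.

Lemma mag_rank_inj x : injective (mag_rank x).
Proof.
move=> i j ij; apply/eqP/negPn/negP => /(precedes_total x)/orP[] /mag_rank_lt;
  by rewrite ij ltnn.
Qed.

Lemma mag_rank_lt_size x i : (mag_rank x i < n)%N.
Proof.
rewrite mag_rankE -[ltnRHS](card_ord n); apply: proper_card.
apply/fintype.properP; split; first exact/fintype.subsetP.
by exists i; rewrite // inE precedes_irr.
Qed.

Definition top (s : nat) x : {set 'I_n} := [set i | (mag_rank x i < s)%N]%SET.

Lemma card_top s x : (#|top s x| <= s)%N.
Proof.
rewrite cardE -(size_map (mag_rank x)) -[leqRHS](size_iota 0 s).
apply: uniq_leq_size.
  by rewrite (map_inj_uniq (@mag_rank_inj x)) enum_uniq.
by move=> r /mapP[i]; rewrite mem_enum inE mem_iota => + ->.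
Qed.

(** The ranks of the [n] entries are distinct and below [n], so they are all
    of [0 .. n - 1]; an entry of rank at least [s] leaves room for every
    rank below [s]. *)
Lemma card_top_full s x i : i \notin top s x -> #|top s x| = s.
Proof.
rewrite inE -leqNgt => si; apply/eqP; rewrite eqn_leq card_top/=.
rewrite cardE -(size_map (mag_rank x)) -[leqLHS](size_iota 0 s).
apply: uniq_leq_size; first exact: iota_uniq.
move=> r; rewrite mem_iota add0n /= => rs.
have rn : (r < n)%N.
  exact: leq_ltn_trans (leq_trans (ltnW rs) si) (mag_rank_lt_size x i).
pose f i := Ordinal (mag_rank_lt_size x i).
have finj : injective f by move=> a b [] /mag_rank_inj.
have [g fg gf] := injF_bij finj.
apply/mapP; exists (g (Ordinal rn)); last first.
  by have := congr1 val (gf (Ordinal rn)).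
by rewrite mem_enum inE; have /= -> := congr1 val (gf (Ordinal rn)).
Qed.

Lemma top_ge s x i j : i \in top s x -> j \notin top s x ->
  `|x j 0| <= `|x i 0|.
Proof.
rewrite !inE -leqNgt => si sj; rewrite leNgt; apply/negP => h.
have /mag_rank_lt : precedes x j i by rewrite /precedes h.
by rewrite ltnNge (leq_trans (ltnW si) sj).
Qed.

(** The last clause merges two cases: either some entry is left out, and
    then exactly [s] of them are kept, or none is, and the level can be 0. *)
Lemma top_threshold s x : exists t : R, [/\ 0 <= t,
  forall i, i \in top s x -> t <= `|x i 0|,
  forall i, i \notin top s x -> `|x i 0| <= t &
  t * #|top s x|%:R = t * s%:R].
Proof.
have [/forallP all_top|/forallPn[i0 i0P]] := boolP [forall i, i \in top s x].
  by exists 0; split; rewrite ?mul0r// => i; rewrite all_top.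
have [i iP imax] :=
  @arg_maxP _ R _ i0 (fun i => i \notin top s x) (fun i => `|x i 0|) i0P.
exists `|x i 0|; split => //.
- by move=> j jt; exact: top_ge iP.
- by rewrite (card_top_full iP).
Qed.

(** Subtracting the threshold makes the large entries nonnegative and all
    others nonpositive, so no other choice of at most [s] indices gives
    more. *)
Lemma top_sum_max s x (I : {set 'I_n}) : (#|I| <= s)%N ->
  \sum_(i in I) `|x i 0| <= \sum_(i in top s x) `|x i 0|.
Proof.
move=> Is; have [t [t0 tle tge tcard]] := top_threshold s x.
pose f i := `|x i 0| - t.
have E (J : {set 'I_n}) :
    \sum_(i in J) `|x i 0| = \sum_(i in J) f i + t * #|J|%:R.
  by rewrite big_split/= sumr_const mulNrn mulr_natr subrK.
rewrite !E; apply: lerD; last by rewrite tcard ler_wpM2l// ler_nat.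
rewrite [leLHS]big_mkcond [leRHS]big_mkcond; apply: ler_sum => i _.
rewrite /f; have [it|it] := boolP (i \in top s x); case: ifPn => // _.
- by rewrite subr_ge0 tle.
- by rewrite subr_le0 tge.
Qed.

Lemma best_approxE s x i :
  best_approx s x i 0 = if i \in top s x then x i 0 else 0.
Proof. by rewrite mxE inE. Qed.

Lemma lpnorm1E (k : nat) (v : 'cV[R]_k) : lpnorm 1%:E v = \sum_(i < k) `|v i 0|.
Proof.
rewrite /lpnorm invr1 powRr1; last first.
  by rewrite sumr_ge0// => i _; exact: powR_ge0.
by apply: eq_bigr => i _; rewrite powRr1.
Qed.

Lemma best_approx_residual_l1 s x :
  lpnorm 1%:E (x - best_approx s x) = \sum_(i | i \notin top s x) `|x i 0|.
Proof.
rewrite lpnorm1E [RHS]big_mkcond; apply: eq_bigr => i _.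
by rewrite mxE [in X in _ + X]mxE best_approxE; case: ifPn => _;
  rewrite ?subrr ?normr0 ?subr0.
Qed.

End top_entries.

(** * Norms and means of the largest entries *)

Section power_means.
Variable R : realType.

(** Young's inequality for the product of [t `^ p] and 1. *)
Lemma powR_young (t p q : R) : 0 <= t -> 0 < p -> p <= q ->
  t `^ p <= p / q * t `^ q + (1 - p / q).
Proof.
move=> t0 p0; rewrite le_eqVlt => /predU1P[<-|pq].
  by rewrite divff ?gt_eqF// mul1r subrr addr0.
have q0 : 0 < q := lt_trans p0 pq.
have qp0 : 0 < q - p by rewrite subr_gt0.
have conj1 : (q / p)^-1 + (q / (q - p))^-1 = 1.
  by rewrite !invf_div -mulrDl addrC subrK divff// gt_eqF.
have := @conjugate_powR _ (t `^ p) 1 (q / p) (q / (q - p)) (powR_ge0 _ _) ler01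
  (divr_gt0 q0 p0) (divr_gt0 q0 qp0) conj1.
rewrite mulr1 powR1 -powRrM [p * _]mulrC divfK ?gt_eqF// !invf_div mul1r.
by rewrite mulrBl divff ?gt_eqF// [_ * (p / q)]mulrC.
Qed.

(** Power means increase with the exponent: Young's inequality is applied to
    [f i / b], and [b = 0] forces all terms to vanish. *)
Lemma power_sum_mono (I : finType) (J : {set I}) (f : I -> R) (S b p q : R) :
  0 < p -> p <= q -> 0 <= b -> (forall i, 0 <= f i) -> #|J|%:R <= S ->
  \sum_(i in J) f i `^ q <= S * b `^ q -> \sum_(i in J) f i `^ p <= S * b `^ p.
Proof.
move=> p0 pq b0 f0 JS fq; have q0 : 0 < q := lt_le_trans p0 pq.
have pn0 : p != 0 by rewrite gt_eqF.
have qn0 : q != 0 by rewrite gt_eqF.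
move: b0 fq; rewrite le_eqVlt => /predU1P[<-|b0] fq.
  move: fq; rewrite powR0// mulr0 => fq; rewrite powR0// mulr0.
  have /eqP : \sum_(i in J) f i `^ q = 0.
    by apply/eqP; rewrite eq_le fq sumr_ge0// => i _; exact: powR_ge0.
  rewrite psumr_eq0; last by move=> i _; exact: powR_ge0.
  move=> /allP fJ; rewrite big1// => i iJ.
  have := fJ i (mem_index_enum _); rewrite iJ/= => /eqP/powR_eq0_eq0 ->.
  by rewrite powR0.
have fE r i : f i `^ r = b `^ r * (f i / b) `^ r.
  by rewrite -powRM ?divr_ge0 ?(ltW b0)// mulrC divfK// gt_eqF.
rewrite (eq_bigr (fun i => b `^ p * (f i / b) `^ p)) => [|i _]; last exact: fE.
rewrite -mulr_sumr mulrC ler_pM2r ?powR_gt0//.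
have fbq : \sum_(i in J) (f i / b) `^ q <= S.
  rewrite -(@ler_pM2l _ (b `^ q)) ?powR_gt0// mulr_sumr [leRHS]mulrC.
  by rewrite (eq_bigr (fun i => f i `^ q)) => [//|i _]; rewrite -fE.
apply: (@le_trans _ _ (\sum_(i in J) (p / q * (f i / b) `^ q + (1 - p / q)))).
  by apply: ler_sum => i _; apply: powR_young => //; rewrite divr_ge0// ltW.
rewrite big_split/= -mulr_sumr sumr_const -[X in _ + X]mulr_natr.
apply: (@le_trans _ _ (p / q * S + (1 - p / q) * S));
  last by rewrite -mulrDl addrC subrK mul1r.
apply: lerD; first by rewrite ler_wpM2l// divr_ge0// ltW.
by rewrite ler_wpM2l// subr_ge0 ler_pdivrMr// mul1r.
Qed.

End power_means.

Section top_norms.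
Variables (R : realType) (n s : nat).
Implicit Types (z : 'cV[R]_n) (b p : R) (q : \bar R).

Lemma invp_fin p : p != 0 -> invp p%:E = p^-1.
Proof. by move=> p0; rewrite /invp inver (negbTE p0). Qed.

Lemma invp_pinfty : invp (+oo%E : \bar R) = 0.
Proof. by rewrite /invp invey. Qed.

Lemma lpnorm_pinfty_le (k : nat) (x : 'cV[R]_k) b : 0 <= b ->
  (forall i, `|x i 0| <= b) -> lpnorm +oo%E x <= b.
Proof. by move=> b0 xb; apply: bigmax_le. Qed.

Lemma le_lpnorm_pinfty (k : nat) (x : 'cV[R]_k) i : `|x i 0| <= lpnorm +oo%E x.
Proof. exact: le_bigmax. Qed.

Lemma sqnorm_finE z p : 0 < p ->
  sqnorm s p%:E z = (\sum_(i in top s z) `|z i 0| `^ p) `^ p^-1.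
Proof.
move=> p0; rewrite /sqnorm /lpnorm; congr (_ `^ _); rewrite [RHS]big_mkcond.
apply: eq_bigr => i _; rewrite best_approxE; case: ifP => // _.
by rewrite normr0 powR0// gt_eqF.
Qed.

(** Hölder's inequality on the [s] largest entries: a bound [b] on their
    mean of order [q] bounds their mean of any smaller order. *)
Lemma top_power_sum z b q p : 0 <= b -> 1 <= p -> (p%:E <= q)%E ->
  sqnorm s q z <= s%:R `^ invp q * b ->
  \sum_(i in top s z) `|z i 0| `^ p <= s%:R * b `^ p.
Proof.
move=> b0 p1; have p0 : 0 < p := lt_le_trans ltr01 p1.
have topS : #|top s z|%:R <= s%:R :> R by rewrite ler_nat card_top.
case: q => [r||]; rewrite ?leeNy_eq//.
- rewrite lee_fin => pr; have r0 : 0 < r := lt_le_trans p0 pr.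
  rewrite sqnorm_finE// invp_fin ?gt_eqF// => H.
  apply: (power_sum_mono p0 pr b0 _ topS) => //.
  have S0 : 0 <= \sum_(i in top s z) `|z i 0| `^ r.
    by rewrite sumr_ge0// => i _; exact: powR_ge0.
  have := ge0_ler_powR (ltW r0) _ _ H; rewrite !nnegrE => /(_ (powR_ge0 _ _)).
  rewrite mulr_ge0 ?powR_ge0// => /(_ isT).
  by rewrite powRM ?powR_ge0// -!powRrM mulVf ?gt_eqF// !powRr1.
- move=> _; rewrite invp_pinfty powRr0 mul1r => H.
  apply: (@le_trans _ _ (\sum_(i in top s z) b `^ p)).
    apply: ler_sum => i it; apply: ge0_ler_powR; rewrite ?nnegrE ?(ltW p0)//.
    apply: le_trans H; have := le_lpnorm_pinfty (best_approx s z) i.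
    by rewrite best_approxE it.
  by rewrite sumr_const -[leLHS]mulr_natl ler_wpM2r ?powR_ge0.
Qed.

(** Every entry outside the [s] largest is at most [b], being dominated by
    an average of those. Hence the entries outside contribute at most
    [s * c * b `^ (p - 1)] to the sum of [p]-th powers, the largest ones at
    most [s * b `^ p], and the total is [s * (b + c) * b `^ (p - 1)]. The
    parameter [L] accommodates both recoveries: [L = 3] for the regular one,
    [L = 1] with a doubled [M] for the penalized one. *)
Lemma lpnorm_le_top z b (c L M : R) (p q : \bar R) : (0 < s)%N ->
  (1%:E <= p)%E -> (p <= q)%E -> 0 <= b -> b <= M -> 0 <= L -> b + c <= L * M ->
  sqnorm s q z <= s%:R `^ invp q * b ->
  \sum_(i | i \notin top s z) `|z i 0| <= s%:R * c ->
  lpnorm p z <= (L * s%:R) `^ invp p * M.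
Proof.
move=> s0 p1 pq b0 bM L0 bcM zq zc.
have S0 : 0 < s%:R :> R by rewrite ltr0n.
have M0 : 0 <= M := le_trans b0 bM.
have [t [t0 tle tge tcard]] := top_threshold s z.
have tb : t <= b.
  rewrite -(ler_pM2l S0) mulrC -tcard.
  have := top_power_sum b0 (lexx 1) (le_trans p1 pq) zq; rewrite powRr1//.
  apply: le_trans; rewrite mulr_natr -sumr_const; apply: ler_sum => i it.
  by rewrite powRr1// tle.
case: p p1 pq => [p||]; rewrite ?leeNy_eq//.
- rewrite lee_fin => p1 pq; have p0 : 0 < p := lt_le_trans ltr01 p1.
  have pm1 : 0 <= p - 1 by rewrite subr_ge0.
  rewrite invp_fin ?gt_eqF// /lpnorm.
  have -> : (L * s%:R) `^ p^-1 * M = (L * s%:R * M `^ p) `^ p^-1.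
    rewrite [in RHS]powRM ?mulr_ge0 ?powR_ge0 ?(ltW S0)//.
    by rewrite -powRrM mulfV ?gt_eqF// powRr1.
  apply: ge0_ler_powR; rewrite ?nnegrE ?invr_ge0 ?(ltW p0)//.
  + by rewrite sumr_ge0// => i _; exact: powR_ge0.
  + by rewrite !mulr_ge0 ?powR_ge0 ?(ltW S0).
  rewrite (bigID (fun i => i \in top s z))/=.
  apply: (@le_trans _ _ (s%:R * b `^ p + s%:R * c * b `^ (p - 1))).
    apply: lerD; first exact: top_power_sum pq zq.
    apply: (@le_trans _ _
        ((\sum_(i | i \notin top s z) `|z i 0|) * b `^ (p - 1))).
      rewrite mulr_suml; apply: ler_sum => i it.
      rewrite -mulr_powRB1// ler_wpM2l// ge0_ler_powR ?nnegrE//.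
      exact: le_trans (tge _ it) tb.
    by rewrite ler_wpM2r ?powR_ge0.
  rewrite -(mulr_powRB1 b0 p0) -(mulr_powRB1 M0 p0).
  rewrite [leLHS](_ : _ = s%:R * ((b + c) * b `^ (p - 1))); last by ring.
  rewrite [leRHS](_ : _ = s%:R * (L * M * M `^ (p - 1))); last by ring.
  rewrite ler_pM2l//; apply: (@le_trans _ _ (L * M * b `^ (p - 1))).
    by rewrite ler_wpM2r ?powR_ge0.
  by rewrite ler_wpM2l ?mulr_ge0// ge0_ler_powR ?nnegrE.
- move=> _; rewrite leye_eq => /eqP qoo.
  move: zq; rewrite qoo invp_pinfty powRr0 mul1r => zq.
  rewrite powRr0 mul1r; apply: lpnorm_pinfty_le => // i.
  apply: le_trans bM; have [it|it] := boolP (i \in top s z);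
    last exact: le_trans (tge _ it) tb.
  apply: le_trans zq; have := le_lpnorm_pinfty (best_approx s z) i.
  by rewrite best_approxE it.
Qed.

End top_norms.

(** * Error of l1 recovery under the condition on H *)

(** With [D] and [E] the l1 norms of the error on and off the support,
    divided by [s], the inequalities [D <= g + kappa * (D + E)] and
    [E <= D + l + 2 * u] combine to a bound on the whole because
    [2 * kappa < 1]. *)
Lemma l1_arith (R : realType) (D E g G u kappa M l : R) :
  0 < 1 - 2 * kappa -> M * (1 - 2 * kappa) = G + u ->
  D <= g + kappa * (D + E) -> E <= D + l + 2 * u -> l <= 0 -> g <= G ->
  D + E <= 2 * M.
Proof. move=> k1 Mk Db cone l0 gG; rewrite -(ler_pM2r k1); lra. Qed.

(** Here the penalty pays for [g]: the more [g] exceeds the noise level [N],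
    the smaller [l]. Bounding [b + E], where [b = g + kappa * (D + E)],
    instead of [b] and [E] separately is what keeps the final constant
    small: [b] and [E] cannot both be near their maxima. *)
Lemma pen_arith (R : realType) (D E g N u kappa M l : R) :
  0 < kappa -> 0 < 1 - 2 * kappa -> M * (1 - 2 * kappa) = 2 * N + u ->
  D <= g + kappa * (D + E) -> E <= D + l + 2 * u -> l <= 2 * (2 * N) - 2 * g ->
  g + kappa * (D + E) + E <= 2 * M.
Proof.
move=> k0 k1 Mk Db cone lN; rewrite -(ler_pM2r k1).
have kD : kappa * D <= kappa * (g + kappa * (D + E)) by rewrite ler_pM2l.
lra.
Qed.

Lemma pen_slack (R : realType) (a c S g N : R) : 0 < S ->
  a + 2 * S * g <= c + 2 * S * (2 * N) -> (a - c) / S <= 2 * (2 * N) - 2 * g.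
Proof. by move=> S0 H; rewrite ler_pdivrMr//; lra. Qed.

Lemma penalty_arith (R : realType) (a c T f g r N : R) : 0 <= T ->
  a + T * f <= c + T * r -> r <= N -> g - N <= f ->
  a + T * g <= c + T * (2 * N).
Proof.
move=> T0 opt rN gf.
by have := ler_wpM2l T0 rN; have := ler_wpM2l T0 gf; lra.
Qed.

Section recovery_error.
Variables (R : realType) (m n s : nat) (A H : 'M[R]_(m, n)) (kappa : R).
Variable q : \bar R.
Hypotheses (s_gt0 : (0 < s)%N).
Hypotheses (kappa_gt0 : 0 < kappa) (kappa_lt : kappa < 2^-1).
Hypotheses (q1 : (1%:E <= q)%E) (HA : condH A s q kappa H).

Let S : R := s%:R.
Let S_gt0 : 0 < S. Proof. by rewrite ltr0n. Qed.
Let k1 : 0 < 1 - 2 * kappa.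
Proof. by rewrite subr_gt0 -ltr_pdivlMl// mulr1. Qed.

(** The triangle inequality on and off [I]: if [v] is not larger than [x] in
    l1 norm, the error off [I] is paid for by the error on [I] and by the
    tail of [x]. *)
Lemma error_off_support (k : nat) (x v : 'cV[R]_k) (I : {set 'I_k}) :
  \sum_(i | i \notin I) `|(v - x) i 0| <=
  \sum_(i in I) `|(v - x) i 0| + (lpnorm 1%:E v - lpnorm 1%:E x)
  + 2 * \sum_(i | i \notin I) `|x i 0|.
Proof.
rewrite !lpnorm1E (bigID (fun i => i \in I) predT (fun i => `|v i 0|))/=.
rewrite (bigID (fun i => i \in I) predT (fun i => `|x i 0|))/=.
have HI : \sum_(i in I) `|x i 0| <=
    \sum_(i in I) `|(v - x) i 0| + \sum_(i in I) `|v i 0|.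
  rewrite -big_split/=; apply: ler_sum => i _; rewrite !mxE distrC.
  by have := ler_normD (x i 0 - v i 0) (v i 0); rewrite subrK.
have HJ : \sum_(i | i \notin I) `|(v - x) i 0| <=
    \sum_(i | i \notin I) `|v i 0| + \sum_(i | i \notin I) `|x i 0|.
  rewrite -big_split/=; apply: ler_sum => i _.
  by rewrite !mxE; exact: ler_normB.
lra.
Qed.

Lemma lpnorm1_split (k : nat) (x : 'cV[R]_k) (I : {set 'I_k}) :
  lpnorm 1%:E x = \sum_(i in I) `|x i 0| + \sum_(i | i \notin I) `|x i 0|.
Proof. by rewrite lpnorm1E (bigID (fun i => i \in I))/=. Qed.

(** The condition on [H], read as a bound [b] on the mean of order [q] of
    the [s] largest entries of [z]. *)
Lemma condH_top (z : 'cV[R]_n) :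
  let b := lpnorm +oo%E (H^T *m A *m z) + kappa * (lpnorm 1%:E z / S) in
  [/\ 0 <= b, sqnorm s q z <= S `^ invp q * b &
      \sum_(i in top s z) `|z i 0| <= S * b].
Proof.
move=> b.
have W0 : 0 <= lpnorm 1%:E z by rewrite lpnorm1E sumr_ge0.
have g0 : 0 <= lpnorm +oo%E (H^T *m A *m z).
  by rewrite /lpnorm; apply: bigmax_ge_id.
have b0 : 0 <= b.
  by rewrite addr_ge0// mulr_ge0 ?(ltW kappa_gt0)// divr_ge0// ltW.
have zq : sqnorm s q z <= S `^ invp q * b.
  apply: le_trans (HA z) _; rewrite -/S powRB; last first.
    by apply/implyP => _; rewrite gt_eqF.
  rewrite powRr1 ?(ltW S_gt0)// /b mulrDr lerD2l.
  by rewrite le_eqVlt; apply/orP; left; apply/eqP; ring.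
split => //; have := top_power_sum b0 (lexx 1) q1 zq; rewrite powRr1//.
by under eq_bigr do rewrite powRr1//.
Qed.

Variables (x v : 'cV[R]_n) (upsilon : R).
Hypothesis xs : nearly_sparse s upsilon x.

Let z := v - x.
Let g := lpnorm +oo%E (H^T *m A *m z).
Let I := top s x.
Let D := (\sum_(i in I) `|z i 0|) / S.
Let E := (\sum_(i | i \notin I) `|z i 0|) / S.
Let b := g + kappa * (D + E).

Let upsilon_ge : \sum_(i | i \notin I) `|x i 0| <= upsilon.
Proof. by rewrite -best_approx_residual_l1. Qed.

Let zW : lpnorm 1%:E z / S = D + E.
Proof. by rewrite (lpnorm1_split z I) mulrDl. Qed.

Let D0 : 0 <= D. Proof. by rewrite divr_ge0 ?(ltW S_gt0)// sumr_ge0. Qed.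
Let E0 : 0 <= E. Proof. by rewrite divr_ge0 ?(ltW S_gt0)// sumr_ge0. Qed.

(** The [s] largest entries of [z] carry at least as much l1 mass as those
    on the support [I] of the best approximation of [x], and so leave at
    most [S * E] outside. *)
Let b_props : [/\ 0 <= b, sqnorm s q z <= S `^ invp q * b, D <= b &
  \sum_(i | i \notin top s z) `|z i 0| <= S * E].
Proof.
have := condH_top z; rewrite zW -/g -/b => -[b0 zq ztop].
have DT : \sum_(i in I) `|z i 0| <= \sum_(i in top s z) `|z i 0|.
  by apply: top_sum_max; exact: card_top.
split => //; first by rewrite ler_pdivrMr// mulrC; exact: le_trans ztop.
rewrite mulrC divfK ?gt_eqF//.
by have := lpnorm1_split z I; rewrite (lpnorm1_split z (top s z)); lra.
Qed.

Let cone : E <= D + (lpnorm 1%:E v - lpnorm 1%:E x) / S + 2 * (S^-1 * upsilon).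
Proof.
rewrite /E ler_pdivrMr// [leRHS](_ : _ = \sum_(i in I) `|z i 0| +
  (lpnorm 1%:E v - lpnorm 1%:E x) + 2 * upsilon); last first.
  by rewrite !mulrDl !divfK ?gt_eqF// -mulrA [S^-1 * _]mulrC divfK ?gt_eqF.
by apply: le_trans (error_off_support x v I) _; rewrite lerD2l ler_wpM2l.
Qed.

Lemma l1_minimizer_error (G : R) (p : \bar R) :
  (1%:E <= p)%E -> (p <= q)%E -> 0 <= upsilon ->
  lpnorm 1%:E v <= lpnorm 1%:E x -> g <= G ->
  lpnorm p (v - x) <=
    (3 * S) `^ invp p * ((G + S^-1 * upsilon) / (1 - 2 * kappa)).
Proof.
move=> p1 pq u0 vx gG; set M := _ / (1 - _).
have Mk : M * (1 - 2 * kappa) = G + S^-1 * upsilon by rewrite divfK// gt_eqF.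
have [b0 zq Db zT] := b_props.
have u1 : 0 <= S^-1 * upsilon by rewrite mulr_ge0// invr_ge0 ltW.
have vx1 : (lpnorm 1%:E v - lpnorm 1%:E x) / S <= 0.
  by rewrite pmulr_lle0 ?invr_gt0// subr_le0.
have w2M : D + E <= 2 * M.
  exact: (l1_arith k1 Mk Db cone vx1 gG).
have kM : kappa * (D + E) <= kappa * (2 * M) by rewrite ler_pM2l.
have bM : b <= M.
  apply: (@le_trans _ _ (G + kappa * (2 * M))); first exact: lerD.
  rewrite -(addrK (S^-1 * upsilon) G) -Mk.
  by rewrite [leLHS](_ : _ = M - S^-1 * upsilon) ?gerBl//; ring.
have E2 : E <= 2 * M by apply: le_trans w2M; rewrite lerDr.
apply: (lpnorm_le_top s_gt0 p1 pq b0 bM _ _ zq zT) => //.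
by apply: le_trans (lerD bM E2) _; rewrite [leLHS](_ : _ = 3 * M) //; ring.
Qed.

Lemma penalized_minimizer_error (N : R) (p : \bar R) :
  (1%:E <= p)%E -> (p <= q)%E ->
  lpnorm 1%:E v + 2 * S * g <= lpnorm 1%:E x + 2 * S * (2 * N) ->
  lpnorm p (v - x) <=
    S `^ invp p * (2 * ((2 * N + S^-1 * upsilon) / (1 - 2 * kappa))).
Proof.
move=> p1 pq vx; set M := _ / (1 - _).
have Mk : M * (1 - 2 * kappa) = 2 * N + S^-1 * upsilon.
  by rewrite divfK// gt_eqF.
have [b0 zq Db zT] := b_props.
have vx1 : (lpnorm 1%:E v - lpnorm 1%:E x) / S <= 2 * (2 * N) - 2 * g.
  exact: pen_slack.
have bE : b + E <= 2 * M := pen_arith kappa_gt0 k1 Mk Db cone vx1.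
rewrite -[S]mul1r; apply: (lpnorm_le_top s_gt0 p1 pq b0 _ _ _ zq zT) => //.
  by apply: le_trans bE; rewrite lerDl.
by rewrite mul1r.
Qed.

End recovery_error.

(** * From error bounds to risk *)

Section observation_noise.
Variables (R : realType) (m : nat).
Implicit Types (h u v : 'cV[R]_m) (U : set 'cV[R]_m).

Lemma dotvC u v : dotv u v = dotv v u.
Proof. by apply: eq_bigr => i _; rewrite mulrC. Qed.

Lemma dotvDr h u v : dotv h (u + v) = dotv h u + dotv h v.
Proof. by rewrite -big_split/=; apply: eq_bigr => i _; rewrite mxE mulrDr. Qed.

Lemma dotvZr h (a : R) v : dotv h (a *: v) = a * dotv h v.
Proof. by rewrite mulr_sumr; apply: eq_bigr => i _; rewrite mxE mulrCA. Qed.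

Lemma dotvNr h v : dotv h (- v) = - dotv h v.
Proof. by rewrite -scaleN1r dotvZr mulN1r. Qed.

Lemma mulmx_tr_dotv (n : nat) (H : 'M[R]_(m, n)) v i :
  (H^T *m v) i 0 = dotv (col i H) v.
Proof. by rewrite mxE; apply: eq_bigr => j _; rewrite !mxE. Qed.

(** The supremum is finite by compactness, and bounds the absolute value by
    symmetry of [U]. *)
Lemma dotv_le_support U h u : uncertainty_set U -> U u ->
  `|dotv h u| <= sup [set dotv u h | u in U].
Proof.
move=> [_ _ cU symU] Uu.
have ub : has_ubound [set dotv u h | u in U].
  have cf : continuous (fun u : 'cV[R]_m => dotv u h).
    apply: (@continuous_big R^o _ +%R 0) => [|i _]; first exact: add_continuous.
    move=> u0.
    by apply: continuousM; [exact: coord_continuous|exact: cst_continuous].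
  have /compact_bounded [M [_ HM]] : compact [set dotv u h | u in U].
    apply: continuous_compact => //; exact: continuous_subspaceT.
  exists (M + 1) => y Uy; apply: le_trans (ler_norm y) _.
  by apply: HM => //; rewrite ltrDl.
rewrite ler_norml lerNl -dotvNr; apply/andP; split.
  by apply: ub_le_sup => //; exists (- u); [exact: symU|exact: dotvC].
by apply: ub_le_sup => //; exists u => //; exact: dotvC.
Qed.

Lemma dotv_noise_le_nu (n : nat) (eps sigma : R) U h u xi :
  0 < sigma -> uncertainty_set U -> U u ->
  `|dotv h xi| <= Num.sqrt (2 * ln (n%:R / eps)) * lpnorm 2%:E h ->
  `|dotv h (sigma *: xi + u)| <= nu n eps sigma U h.
Proof.
move=> sg0 HU Uu Hxi; rewrite dotvDr dotvZr /nu addrC.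
apply: (le_trans (ler_normD _ _)); apply: lerD; first exact: dotv_le_support.
by rewrite normrM gtr0_norm// -mulrA ler_pM2l.
Qed.

End observation_noise.

Section risk_bound.
Variables (R : realType) (m n s : nat) (A H : 'M[R]_(m, n)).
Variables (sigma eps : R) (U : set 'cV[R]_m).
Variables (d : measure_display) (Omega : measurableType d).
Variables (P : probability Omega R) (xi : Omega -> 'cV[R]_m).
Hypotheses (sigma_gt0 : 0 < sigma) (HU : uncertainty_set U).
Hypotheses (eps_gt0 : 0 < eps) (eps_lt1 : eps < 1) (xiN : std_gaussian P xi).

(** When no column sees a large noise, the hypothesis applies to all [x] and
    [u] at once. So the bad event lies in a measurable set of probability at
    most [eps], which bounds its outer measure. *)
Lemma risk_le (xhat : 'cV[R]_m -> 'cV[R]_n) (p : \bar R) (upsilon delta : R) :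
  (forall x y, nearly_sparse s upsilon x ->
    (forall i, `|dotv (col i H) (A *m x - y)| <= nu n eps sigma U (col i H)) ->
    lpnorm p (xhat y - x) <= delta) ->
  (risk P A sigma U xi p xhat eps s upsilon <= delta%:E)%E.
Proof.
move=> Hx; apply: ereal_inf_lbound; exists delta => //=.
apply: le_trans (large_noise_le xiN H eps_gt0 eps_lt1).
rewrite -measurable_mu_extE; last exact: (measurable_large_noise xiN).
apply: le_mu_ext => w /= [x [u [xs Uu]]]; rewrite ltNge => /negP bad.
apply/not_existsP => small; apply: bad; apply: Hx => // i.
rewrite (_ : A *m x - _ = - (sigma *: xi w + u)); last first.
  by rewrite -addrA opprD addNKr.
rewrite dotvNr normrN; apply: dotv_noise_le_nu => //.
by rewrite leNgt; apply/negP; exact: small.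
Qed.

Lemma nu_le_max i : nu n eps sigma U (col i H) <= nu_max eps sigma U H.
Proof. exact: (le_bigmax _ (fun i => nu n eps sigma U (col i H))). Qed.

End risk_bound.

Unset Implicit Arguments.
Set Strict Implicit.

Theorem proposition7 (R : realType) (m n s : nat) (A H : 'M[R]_(m, n))
    (kappa : R) (q : \bar R) (sigma eps : R) (U : set 'cV[R]_m)
    (d : measure_display) (Omega : measurableType d) (P : probability Omega R)
    (xi : Omega -> 'cV[R]_m) :
  (0 < s)%N -> (s <= m)%N ->
  0 < kappa -> kappa < 2^-1 ->
  (1%:E <= q)%E ->
  condH A s q kappa H ->
  0 < sigma ->
  uncertainty_set U ->
  0 < eps -> eps < 1 ->
  std_gaussian P xi ->
  (forall (rho : 'I_n -> R) (xreg : 'cV[R]_m -> 'cV[R]_n),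
     (forall i, 0 < rho i) ->
     (forall i, nu n eps sigma U (col i H) <= rho i) ->
     regular_recovery A H rho xreg ->
     forall (p : \bar R) (upsilon : R),
       (1%:E <= p)%E -> (p <= q)%E -> 0 <= upsilon ->
       (risk P A sigma U xi p xreg eps s upsilon
        <= ((3 * s%:R) `^ invp p
            * ((\big[Num.max/0]_(i < n) rho i + nu_max eps sigma U H
                + s%:R^-1 * upsilon) / (1 - 2 * kappa)))%:E)%E) /\
  (forall xpen : 'cV[R]_m -> 'cV[R]_n,
     penalized_recovery A H s 2 xpen ->
     forall (p : \bar R) (upsilon : R),
       (1%:E <= p)%E -> (p <= q)%E -> 0 <= upsilon ->
       (risk P A sigma U xi p xpen eps s upsilon
        <= (3 * s%:R `^ invp p
            * ((2 * nu_max eps sigma U H + s%:R^-1 * upsilon)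
               / (1 - 2 * kappa)))%:E)%E).
Proof.
move=> s0 _ k0 k12 q1 HA sigma0 HU eps0 eps1 xiN.
have nu_le := nu_le_max H sigma eps U.
have numax0 : 0 <= nu_max eps sigma U H by exact: bigmax_ge_id.
split.
- move=> rho xreg rho0 nu_rho [_ xregP] p upsilon p1 pq u0.
  apply: (risk_le (H := H) sigma0 HU eps0 eps1 xiN) => x y xs noise.
  have xfeas : reg_feasible A H rho y x.
    by move=> i; exact: le_trans (noise i) (nu_rho i).
  have [vfeas vmin] := xregP y (ex_intro _ x xfeas).
  apply: (l1_minimizer_error s0 k0 k12 q1 HA xs p1 pq u0 (vmin _ xfeas)).
  have rhomax i : rho i <= \big[Num.max/0]_(i < n) rho i := le_bigmax _ rho i.
  apply: lpnorm_pinfty_le => [|i].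
    by rewrite addr_ge0//; exact: bigmax_ge_id.
  rewrite -mulmxA mulmx_tr_dotv mulmxBr.
  rewrite (_ : _ - _ = (A *m xreg y - y) - (A *m x - y)); last first.
    by rewrite opprB addrA subrK.
  rewrite dotvDr dotvNr; apply: (le_trans (ler_normB _ _)); apply: lerD.
    exact: le_trans (vfeas i) (rhomax i).
  exact: le_trans (noise i) (nu_le i).
- move=> xpen [_ xpenP] p upsilon p1 pq u0.
  apply: (risk_le (H := H) sigma0 HU eps0 eps1 xiN) => x y xs noise.
  have noisemax : lpnorm +oo%E (H^T *m (A *m x - y)) <= nu_max eps sigma U H.
    apply: lpnorm_pinfty_le => // i; rewrite mulmx_tr_dotv.
    exact: le_trans (noise i) (nu_le i).
  (* The residual of the estimate is at least g minus the noise level, where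
     g is the sup norm of H^T A applied to the error; this turns optimality
     into a bound involving g. *)
  have resid : lpnorm +oo%E (H^T *m A *m (xpen y - x)) - nu_max eps sigma U H <=
      lpnorm +oo%E (H^T *m (A *m xpen y - y)).
    rewrite lerBlDr; apply: lpnorm_pinfty_le => [|i].
      by rewrite addr_ge0//; exact: bigmax_ge_id.
    rewrite -mulmxA mulmx_tr_dotv mulmxBr.
    rewrite (_ : _ - _ = (A *m xpen y - y) - (A *m x - y)); last first.
      by rewrite opprB addrA subrK.
    rewrite dotvDr dotvNr; apply: (le_trans (ler_normB _ _)); apply: lerD.
      by rewrite -mulmx_tr_dotv; exact: le_lpnorm_pinfty.
    exact: le_trans (noise i) (nu_le i).
  have S0 : 0 < s%:R :> R by rewrite ltr0n.
  have obj : lpnorm 1%:E (xpen y)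
        + 2 * s%:R * lpnorm +oo%E (H^T *m A *m (xpen y - x))
      <= lpnorm 1%:E x + 2 * s%:R * (2 * nu_max eps sigma U H).
    by apply: penalty_arith (xpenP y x) noisemax resid; rewrite mulr_ge0// ltW.
  (* The error is bounded with the factor 2, which is below 3. *)
  apply: le_trans (penalized_minimizer_error s0 k0 k12 q1 HA xs p1 pq obj) _.
  rewrite [leRHS](_ : _ = s%:R `^ invp p *
    (3 * ((2 * nu_max eps sigma U H + s%:R^-1 * upsilon) / (1 - 2 * kappa))));
      last by ring.
  rewrite ler_wpM2l ?powR_ge0// ler_wpM2r ?ler_nat// divr_ge0//.
    by rewrite addr_ge0// mulr_ge0// invr_ge0 ltW.
  by rewrite subr_ge0 -ler_pdivlMl// mulr1 ltW.
Qed.
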